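(* Let $H$ be a Hilbert space, $C:\operatorname{dom}(C)\subseteq H\to H$ a linear, closed, densely defined operator that is quasi-skew-selfadjoint, and $\alpha\in L(H)$ selfadjoint. Moreover, assume that $\alpha[\operatorname{dom}(C)]\subseteq\operatorname{dom}(C)$ and that $[\alpha,C]$ is continuous. Then $$\operatorname{skew}(\alpha C):=\tfrac12\,\overline{\alpha C-(\alpha C)^*}$$ is skew-selfadjoint.
   Context: Hilbert spaces are real. $C$ is quasi-skew-selfadjoint if $\operatorname{dom}(C)=\operatorname{dom}(C^* )$ and $\operatorname{sym}C:=\frac12\overline{(C+C^* )}$ is bounded. The commutator is $[\alpha,C]:=\alpha C-C\alpha$ with domain $\operatorname{dom}(C)$; ''continuous'' means bounded on this domain. An operator $T$ is skew-selfadjoint if $T^*=-T$. *)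

(* Defs.v *)
From HB Require Import structures.
From mathcomp Require Import all_boot all_order all_algebra.
From mathcomp Require Import all_classical all_reals all_analysis.
Set Implicit Arguments.
Unset Strict Implicit.
Unset Printing Implicit Defensive.
Import Order.TTheory GRing.Theory Num.Theory.
Import numFieldNormedType.Exports.
Local Open Scope classical_set_scope.
Local Open Scope ring_scope.

HB.mixin Record isHilbert (R : realType) H of CompleteNormedModule R H := {
  inner : {dot H for (idfun : R -> R)};
  inner_norm : forall x : H, inner x x = `|x| ^+ 2
}.

#[short(type="hilbertType")]
HB.structure Definition Hilbert (R : realType) :=
  { H of isHilbert R H & CompleteNormedModule R H }.

Section Operators.
Variables (R : realType) (H : hilbertType R).

(* Partially defined operators are represented by their graphs, subsets of
   H * H. The constructions below make sense for every such subset, also for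
   adjoints and closures that are not single-valued; that a subset is the graph
   of a linear operator is the predicate [is_operator]. *)
Implicit Types S T : set (H * H).

Definition is_operator T : Prop :=
  [/\ T 0,
      forall (a : R) p q, T p -> T q -> T (a *: p + q) &
      forall x y z, T (x, y) -> T (x, z) -> y = z].

Definition dom T : set H := fst @` T.

Definition densely_defined T : Prop := dense (dom T).

Definition is_bounded T : Prop :=
  exists M : R, forall x y, T (x, y) -> `|y| <= M * `|x|.

Definition graph (f : H -> H) : set (H * H) := [set p | p.2 = f p.1].

Definition opadd S T : set (H * H) :=
  [set p | exists y z, [/\ S (p.1, y), T (p.1, z) & p.2 = y + z]].

Definition opscale (a : R) T : set (H * H) :=
  [set p | exists2 y, T (p.1, y) & p.2 = a *: y].

Definition opopp T : set (H * H) := opscale (-1) T.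

Definition opsub S T : set (H * H) := opadd S (opopp T).

(* In [relation_scope], [S \; T] applies T first. *)
Definition opcomp S T : set (H * H) := (S \; T)%relation.

Definition adjoint T : set (H * H) :=
  [set p | forall x y, T (x, y) -> inner y p.1 = inner x p.2].

Definition selfadjoint T : Prop :=
  [/\ is_operator T, densely_defined T & adjoint T = T].

(* A set of pairs that is not an operator may satisfy [adjoint T = opopp T],
   for instance {0} * H, so the first two conditions are needed. *)
Definition skew_selfadjoint T : Prop :=
  [/\ is_operator T, densely_defined T & adjoint T = opopp T].

(* [closure] is the topological closure of the graph in H * H. *)
Definition sym_part T : set (H * H) :=
  opscale 2^-1 (closure (opadd T (adjoint T))).

Definition skew_part T : set (H * H) :=
  opscale 2^-1 (closure (opsub T (adjoint T))).

Definition quasi_skew_selfadjoint T : Prop :=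
  dom T = dom (adjoint T) /\ is_bounded (sym_part T).

(* Its domain is dom T as soon as S is everywhere defined and maps dom T into
   itself. *)
Definition commutator S T : set (H * H) := opsub (opcomp S T) (opcomp T S).

End Operators.

(* Main.v *)
Require Import Defs.
From HB Require Import structures.
From mathcomp Require Import all_boot all_order all_algebra.
From mathcomp Require Import all_classical all_reals all_analysis.
From mathcomp Require Import ring lra.
Import Order.TTheory GRing.Theory Num.Theory.
Import numFieldNormedType.Exports.
Local Open Scope classical_set_scope.
Local Open Scope ring_scope.

(** Since [C + C^*] is bounded on the common domain of [C] and [C^*], it is
    the restriction of [2 S] for a bounded symmetric [S] defined everywhere,
    and [A := C - S] satisfies [A^* = - A] ([quasi_skew_selfadjoint_split]).
    The commutator of [alpha] with [A] differs from the one with [C] by the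
    bounded operator [P := alpha S - S alpha], so it too extends to a bounded
    operator [N], and on [dom C]

      [alpha C - (alpha C)^* = 2 alpha A - N + P].

    This operator is skew-symmetric because [N] is symmetric and [P] is
    antisymmetric. Its closure is therefore contained in minus its adjoint
    ([closure_skew_selfadjoint]), and what has to be shown is that every
    element of the domain of the adjoint is approximated, in the graph norm,
    by elements of [dom A]. As [A] is skew-selfadjoint, a vector [y] belongs
    to the domain of the adjoint only if [alpha y] belongs to [dom A], and
    what remains is the inclusion [A alpha + N <= closure (alpha A)] of
    [closure_mul].

    The approximants are [x := (1 + e A)^-1 y] with [e > 0] tending to [0].
    The resolvents [(1 + e A)^-1] exist by the projection theorem
    ([resolvent_surj]), are contractions and tend strongly to the identity
    ([resolvent_cvg]). Commuting [alpha] with the resolvent produces only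
    terms that involve the bounded operator [N], and these converge; this
    gives [alpha A x --> A (alpha y) + N y].

    Operators are handled through their graphs: [A (x, a)] says that [x] is in
    [dom A] with [A x = a], and the resolvent is the relation
    [A (x, a) /\ x + e *: a = y] between [y] and [x]. *)

(** * The inner product *)

Section InnerProduct.
Context {R : realType} {H : hilbertType R}.
Implicit Types (x y z : H) (a : R).

Lemma innerC x y : inner x y = inner y x.
Proof. by rewrite hermC /= expr0 mul1r. Qed.

Lemma innerDl x y z : inner (x + y) z = inner x z + inner y z.
Proof. exact: linearDl. Qed.

Lemma innerZl a x z : inner (a *: x) z = a * inner x z.
Proof. exact: linearZl_LR. Qed.

Lemma innerNl x z : inner (- x) z = - inner x z.
Proof. exact: linearNl. Qed.

Lemma inner0l z : inner 0 z = 0.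
Proof. exact: linear0l. Qed.

Lemma innerDr x y z : inner z (x + y) = inner z x + inner z y.
Proof. by rewrite !(innerC z) innerDl. Qed.

Lemma innerZr a x z : inner z (a *: x) = a * inner z x.
Proof. by rewrite !(innerC z) innerZl. Qed.

Lemma innerNr x z : inner z (- x) = - inner z x.
Proof. by rewrite !(innerC z) innerNl. Qed.

Lemma inner0r z : inner z 0 = 0.
Proof. by rewrite innerC inner0l. Qed.

Definition innerE :=
  (innerDl, innerDr, innerZl, innerZr, innerNl, innerNr, inner0l, inner0r).

Lemma inner_self_eq0 x : inner x x = 0 -> x = 0.
Proof. by rewrite inner_norm => /eqP; rewrite expf_eq0 /= normr_eq0 => /eqP. Qed.

(** Identities between linear combinations of vectors are reduced to
    identities between scalars. *)
Lemma inner_inj x y : (forall z, inner x z = inner y z) -> x = y.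
Proof.
move=> xy; apply/eqP; rewrite -subr_eq0; apply/eqP/inner_self_eq0.
by rewrite innerDl innerNl xy subrr.
Qed.

(** A vector [v] whose distance to the origin is, up to [e ^+ 2], minimal on
    the line [v + t *: u] is almost orthogonal to [u]; here [p] is the inner
    product of [u] and [v], and [q] is the squared norm of [u]. Evaluate the
    polynomial at its minimum [t = p / q]; for [q = 0] it is affine, which forces
    [p = 0]. *)
Lemma quadratic_bound (p q e : R) : 0 <= q -> 0 <= e ->
  (forall t, 0 <= q * t ^+ 2 - 2 * t * p + e ^+ 2) -> p ^+ 2 <= e ^+ 2 * q.
Proof.
move=> q0 e0 pos.
have [q_eq0|qN0] := eqVneq q 0.
  have [->|pN0] := eqVneq p 0; first by rewrite q_eq0 expr0n mulr0.
  have := pos ((e ^+ 2 + 1) / (2 * p)).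
  suff -> : q * ((e ^+ 2 + 1) / (2 * p)) ^+ 2 -
            2 * ((e ^+ 2 + 1) / (2 * p)) * p + e ^+ 2 = - 1 by lra.
  by rewrite q_eq0; field.
have qgt0 : 0 < q by rewrite lt_neqAle eq_sym qN0.
have := pos (p / q).
suff -> : q * (p / q) ^+ 2 - 2 * (p / q) * p + e ^+ 2 = e ^+ 2 - p ^+ 2 / q.
  by rewrite subr_ge0 ler_pdivrMr.
by field.
Qed.

Lemma Cauchy_Schwarz x y : `|inner x y| <= `|x| * `|y|.
Proof.
rewrite -(@ler_pXn2r _ 2) ?nnegrE ?mulr_ge0 // exprMn real_normK ?num_real //.
apply: quadratic_bound => // t.
suff -> : `|y| ^+ 2 * t ^+ 2 - 2 * t * inner x y + `|x| ^+ 2 =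
  `|x - t *: y| ^+ 2 by exact: sqr_ge0.
rewrite -!inner_norm !innerE (innerC y x); ring.
Qed.

End InnerProduct.

(** * Completeness and closures *)

Lemma le_mul_eps_le0 {R : realType} (c K : R) :
  (forall e, 0 < e -> c <= K * e) -> c <= 0.
Proof.
move=> cK; apply/ler_addgt0Pr => e e0; rewrite add0r.
have K1 : 0 < `|K| + 1 by rewrite ltr_pwDr.
apply: (le_trans (cK (e / (`|K| + 1)) _)); first exact: divr_gt0.
rewrite mulrCA ler_piMr ?(ltW e0) // ler_pdivrMr // mul1r.
by rewrite (le_trans (ler_norm K)) // lerDl.
Qed.

(** A form of Cantor's intersection theorem, used wherever completeness is:
    [P e] is the set of approximate solutions with error [e], and no sequence
    of them has to be chosen. *)
Lemma nested_limit {R : realType} {V : completeNormedModType R}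
    (P : R -> set V) (K : R) :
  (forall e, 0 < e -> P e !=set0) ->
  (forall d e, 0 < d -> d <= e -> P d `<=` P e) ->
  (forall e x y, 0 < e -> P e x -> P e y -> `|x - y| <= K * e) ->
  exists l, forall e x, 0 < e -> P e x -> `|l - x| <= K * e.
Proof.
move=> P0 Pmono Pdiam.
pose F := filter_from [set e : R | 0 < e] P.
have FF : ProperFilter F.
  apply: filter_from_proper; last by move=> e /P0.
  apply: filter_from_filter; first by exists 1 => /=.
  move=> d e /= d0 e0; have m0 : 0 < Num.min d e by rewrite lt_min d0.
  exists (Num.min d e) => // x Px.
  by split; apply: Pmono Px => //; rewrite ge_min lexx ?orbT.
have K1 : 0 < `|K| + 1 by rewrite ltr_pwDr.
have Fcvg : cvg F.
  apply/cauchy_cvgP/cauchyP => e e0.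
  have d0 : 0 < e / (`|K| + 1) by exact: divr_gt0.
  have [x Px] := P0 _ d0; exists x, (e / (`|K| + 1)) => // y Py.
  rewrite -ball_normE /=; apply: le_lt_trans (Pdiam _ _ _ d0 Px Py) _.
  rewrite mulrCA gtr_pMr // ltr_pdivrMr // mul1r.
  by rewrite (le_lt_trans (ler_norm K)) // ltrDl.
exists (lim F) => e x e0 Px; apply/ler_addgt0Pr => d d0.
have [e' /= e'0 Pe'] : F (ball (lim F) d) by apply: Fcvg; exact: nbhsx_ballx.
have m0 : 0 < Num.min e e' by rewrite lt_min e0.
have [y Py] := P0 _ m0.
have /Pe' : P e' y by apply: Pmono Py => //; rewrite ge_min lexx orbT.
rewrite -ball_normE /= => ly.
have Pey : P e y by apply: Pmono Py => //; rewrite ge_min lexx.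
rewrite (le_trans (ler_distD y _ _)) // addrC lerD ?(ltW ly) //.
exact: Pdiam.
Qed.

Section Graphs.
Context {R : realType} {H : hilbertType R}.
Implicit Types (x y z : H) (S T : set (H * H)).

Lemma closureP T x y :
  closure T (x, y) <-> forall e, 0 < e ->
    exists u v, [/\ T (u, v), `|x - u| < e & `|y - v| < e].
Proof.
split=> [clT e e0|approx B].
  have /clT [[u v] [Tuv [/= xu yv]]] : nbhs (x, y) (ball x e `*` ball y e).
    by exists (ball x e, ball y e) => //; split; exact: nbhsx_ballx.
  by exists u, v; split=> //; [move: xu|move: yv]; rewrite -ball_normE.
rewrite -nbhs_ballE => -[e /= e0 subB].
have [u [v [Tuv xu yv]]] := approx e e0.
by exists (u, v); split=> //; apply: subB; split; rewrite -ball_normE.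
Qed.

Lemma dense_approx T x e : densely_defined T -> 0 < e ->
  exists u v, T (u, v) /\ `|x - u| < e.
Proof.
move=> dT e0.
have [|u [xu [[u' v] Tuv /= uu']]] := dT (ball x e) _ (ball_open x e).
  by exists x; exact: ballxx.
by exists u', v; split=> //; rewrite uu'; move: xu; rewrite -ball_normE.
Qed.

End Graphs.

(** * Linear relations and their adjoints *)

Section Relations.
Context {R : realType} {H : hilbertType R}.
Implicit Types (x y z : H) (S T : set (H * H)).

Lemma operatorB T x y x' y' :
  is_operator T -> T (x, y) -> T (x', y') -> T (x - x', y - y').
Proof.
move=> [_ lin _] Txy Txy'; have := lin (-1) _ _ Txy' Txy.
by rewrite scaleN1r addrC.
Qed.

Lemma closure_linear T (a : R) (p q : H * H) :
  (forall p q, T p -> T q -> T (a *: p + q)) ->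
  closure T p -> closure T q -> closure T (a *: p + q).
Proof.
case: p q => [x y] [x' y'] lin Tp Tq; apply/closureP => e e0.
have a1 : 0 < `|a| + 1 by rewrite ltr_pwDr.
have d0 : 0 < e / (`|a| + 1) by exact: divr_gt0.
have [u [v [Tuv xu yv]]] := (closureP _ _ _).1 Tp _ d0.
have [u' [v' [Tuv' xu' yv']]] := (closureP _ _ _).1 Tq _ d0.
have combine (r r' s s' : H) : `|r - s| < e / (`|a| + 1) ->
    `|r' - s'| < e / (`|a| + 1) -> `|a *: r + r' - (a *: s + s')| < e.
  move=> rs rs'; have -> : a *: r + r' - (a *: s + s') =
    a *: (r - s) + (r' - s') by apply: inner_inj => w; rewrite !innerE; ring.
  apply: le_lt_trans (ler_normD _ _) _; rewrite normrZ.
  have -> : e = `|a| * (e / (`|a| + 1)) + e / (`|a| + 1).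
    by field; rewrite gt_eqF.
  by rewrite ler_ltD // ler_wpM2l // ltW.
exists (a *: u + u'), (a *: v + v'); split; try exact: combine.
exact: (lin (u, v) (u', v')).
Qed.

Lemma densely_defined_sub S T : densely_defined S ->
  (forall x y, S (x, y) -> exists z, T (x, z)) -> densely_defined T.
Proof.
move=> dS ST O O0 oO; have [x [Ox [[x' y] Sxy /= xx']]] := dS O O0 oO.
rewrite {}xx' in Sxy; have [z Txz] := ST _ _ Sxy.
by exists x; split=> //; exists (x, z).
Qed.

Lemma dense_inner_inj T y z : densely_defined T ->
  (forall u v, T (u, v) -> inner u y = inner u z) -> y = z.
Proof.
move=> dT yz; apply/eqP; rewrite -subr_eq0 -normr_le0.
have sq : `|y - z| ^+ 2 <= 0.
  apply: (@le_mul_eps_le0 _ _ `|y - z|) => e e0.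
  have [u [v [Tuv uyz]]] := dense_approx _ (y - z) _ dT e0.
  have -> : `|y - z| ^+ 2 = inner (y - z - u) (y - z).
    have u0 : inner u (y - z) = 0.
      by rewrite innerDr innerNr (yz _ _ Tuv) subrr.
    by rewrite -inner_norm [RHS]innerDl innerNl u0 subr0.
  apply: le_trans (ler_norm _) (le_trans (Cauchy_Schwarz _ _) _).
  by rewrite mulrC ler_wpM2l // ltW.
by rewrite leNgt; apply/negP => gt0; have := exprn_gt0 2 gt0; rewrite ltNge sq.
Qed.

(** [T |-> adjoint T] is an antitone Galois connection with itself; this
    turns closedness of adjoints into invariance under closure. *)
Lemma adjoint_sym S T : S `<=` adjoint T -> T `<=` adjoint S.
Proof.
move=> ST [x y] Txy u v /ST /= /(_ _ _ Txy) /=.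
by rewrite (innerC v) (innerC u).
Qed.

Lemma adjoint_closed T : closure (adjoint T) `<=` adjoint T.
Proof.
move=> [p q] cl x y Txy /=; apply/eqP; rewrite -subr_eq0 -normr_le0.
apply: (@le_mul_eps_le0 _ _ (`|y| + `|x|)) => e e0.
have [p' [q' [Tpq pp' qq']]] := (closureP _ _ _).1 cl _ e0.
have -> : inner y p - inner x q = inner y (p - p') - inner x (q - q').
  by rewrite !innerE (Tpq _ _ Txy) /=; ring.
rewrite (le_trans (ler_normB _ _)) // mulrDl.
by rewrite lerD // (le_trans (Cauchy_Schwarz _ _)) // ler_wpM2l // ltW.
Qed.

Lemma adjoint_closure T : adjoint (closure T) = adjoint T.
Proof.
apply/seteqP; split=> [p Tp x y Txy|].
  by apply: Tp; exact: subset_closure.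
apply: adjoint_sym => p clp; apply: adjoint_closed.
by apply: closure_subset clp; exact: adjoint_sym.
Qed.

Lemma is_operator_adjoint T : densely_defined T -> is_operator (adjoint T).
Proof.
move=> dT; split.
- by move=> x y _; rewrite /= !inner0r.
- move=> a [p q] [p' q'] Tp Tq x y Txy /=.
  by rewrite !innerE (Tp _ _ Txy) (Tq _ _ Txy).
- move=> x y z Txy Txz; apply: (dense_inner_inj T) => // u v Tuv.
  by rewrite -(Txy _ _ Tuv) -(Txz _ _ Tuv).
Qed.

Lemma is_operator_graph (f : {linear H -> H}) : is_operator (graph f).
Proof.
split; first by rewrite /graph /= linear0.
- by move=> a [x y] [x' y']; rewrite /graph /= => -> ->; rewrite linearP.
- by move=> x y z; rewrite /graph /= => -> ->.
Qed.

Lemma is_operator_opadd S T :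
  is_operator S -> is_operator T -> is_operator (opadd S T).
Proof.
move=> [S0 Slin Suniq] [T0 Tlin Tuniq]; split.
- by exists 0, 0; rewrite addr0.
- move=> a [x r] [x' r'] [y [z [Sy Tz /= ->]]] [y' [z' [Sy' Tz' /= ->]]].
  exists (a *: y + y'), (a *: z + z'); split.
  + exact: (Slin a (x, y) (x', y')).
  + exact: (Tlin a (x, z) (x', z')).
  + by rewrite /= scalerDr addrACA.
- move=> x r r' [y [z [Sy Tz /= ->]]] [y' [z' [Sy' Tz' /= ->]]].
  by rewrite (Suniq _ _ _ Sy Sy') (Tuniq _ _ _ Tz Tz').
Qed.

Lemma is_operator_opscale (a : R) T : is_operator T -> is_operator (opscale a T).
Proof.
move=> [T0 Tlin Tuniq]; split.
- by exists 0; rewrite //= scaler0.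
- move=> b [x r] [x' r'] [y Ty /= ->] [y' Ty' /= ->].
  exists (b *: y + y'); first exact: (Tlin b (x, y) (x', y')).
  by rewrite /= scalerDr !scalerA mulrC.
- move=> x r r' [y Ty /= ->] [y' Ty' /= ->].
  by rewrite (Tuniq _ _ _ Ty Ty').
Qed.

Lemma is_operator_opcomp S T :
  is_operator S -> is_operator T -> is_operator (opcomp S T).
Proof.
move=> [S0 Slin Suniq] [T0 Tlin Tuniq]; split.
- by exists 0.
- move=> a [x y] [x' y'] [z Tz Sz] [z' Tz' Sz'].
  exists (a *: z + z').
  + exact: (Tlin a (x, z) (x', z')).
  + exact: (Slin a (z, y) (z', y')).
- move=> x y y' [z /= Tz Sz] [z' /= Tz' Sz'].
  by move: Sz'; rewrite -(Tuniq _ _ _ Tz Tz'); exact: Suniq.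
Qed.

Lemma is_operator_opsub S T :
  is_operator S -> is_operator T -> is_operator (opsub S T).
Proof. by move=> oS oT; apply: is_operator_opadd => //; exact: is_operator_opscale. Qed.

Lemma opsubP S T x y : opsub S T (x, y) <->
  exists u v, [/\ S (x, u), T (x, v) & y = u - v].
Proof.
split=> [[u [w [Su [v Tv /= ->] /= ->]]]|[u [v [Su Tv ->]]]].
  by exists u, v; rewrite scaleN1r.
by exists u, (- v); split=> //; exists v; rewrite //= scaleN1r.
Qed.

Lemma opoppP T x y : opopp T (x, y) <-> T (x, - y).
Proof.
split=> [[v Tv /= ->]|Txy]; first by rewrite scaleN1r opprK.
by exists (- y); rewrite //= scaleN1r opprK.
Qed.

End Relations.

(** * Bounded operators *)

Section Bounded.
Context {R : realType} {H : hilbertType R}.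
Implicit Types (x y z : H) (S T : set (H * H)).

Lemma is_bounded_closure T : is_bounded T -> is_bounded (closure T).
Proof.
move=> [M bT]; exists M => x y clT; rewrite -subr_le0.
apply: (@le_mul_eps_le0 _ _ (`|M| + 1)) => e e0.
have [u [v [Tuv xu yv]]] := (closureP _ _ _).1 clT _ e0.
have := bT _ _ Tuv.
have yle : `|y| <= `|v| + `|y - v|.
  by rewrite addrC -{1}(subrK v y) ler_normD.
have Mle : M * (`|u| - `|x|) <= `|M| * e.
  apply: le_trans (ler_norm _) _; rewrite normrM ler_wpM2l //.
  by rewrite (le_trans (ler_dist_dist _ _)) // distrC ltW.
by move=> vle; lra.
Qed.

Lemma dense_bounded_total T x : is_operator T -> densely_defined T ->
  is_bounded T -> exists y, closure T (x, y).
Proof.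
move=> oT dT [M bT].
pose P (e : R) v := exists2 u, T (u, v) & `|x - u| <= e.
have [|||y yP] := @nested_limit _ _ P (`|M| * 2).
- move=> e e0; have [u [v [Tuv xu]]] := dense_approx _ x _ dT e0.
  by exists v, u => //; exact: ltW.
- by move=> d e _ de v [u Tuv xu]; exists u => //; exact: le_trans de.
- move=> e v v' e0 [u Tuv xu] [u' Tuv' xu'].
  rewrite (le_trans (bT _ _ (operatorB _ _ _ _ _ oT Tuv Tuv'))) //.
  rewrite (le_trans (ler_wpM2r _ (ler_norm M))) // -mulrA ler_wpM2l //.
  by rewrite (le_trans (ler_distD x _ _)) // (distrC u); lra.
exists y; apply/closureP => e e0.
have M1 : 0 < `|M| * 2 + 1 by rewrite ltr_pwDr // mulr_ge0.
have d0 : 0 < e / (`|M| * 2 + 1) by exact: divr_gt0.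
have [u [v [Tuv xu]]] := dense_approx _ x _ dT d0.
exists u, v; split=> //.
  rewrite (lt_le_trans xu) // ler_pdivrMr // ler_peMr ?(ltW e0) //.
  by rewrite lerDr mulr_ge0.
apply: le_lt_trans (yP _ _ d0 _) _; first by exists u => //; exact: ltW.
by rewrite mulrCA gtr_pMr // ltr_pdivrMr // mul1r ltrDl.
Qed.

(** The extension is the closure of [T]. *)
Lemma bounded_extension T :
  is_operator T -> densely_defined T -> is_bounded T ->
  exists f : {linear H -> H},
    is_bounded (graph f) /\ forall x y, T (x, y) -> f x = y.
Proof.
move=> oT dT bT; have [M clb] := is_bounded_closure _ bT.
have /choice [f fP] := fun x => dense_bounded_total _ x oT dT bT.
have cllin a p q := @closure_linear _ _ T a p q (let: And3 _ lin _ := oT in lin a).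
have cluniq x y z : closure T (x, y) -> closure T (x, z) -> y = z.
  move=> Txy Txz; apply/eqP; rewrite eq_sym -subr_eq0 -normr_le0.
  have := cllin (-1) _ _ Txy Txz; rewrite scaleN1r addrC.
  move=> /(clb (x - x) (z - y)).
  by rewrite subrr normr0 mulr0.
have flin : linear f.
  move=> a x y; apply: (cluniq (a *: x + y)); first exact: fP.
  exact: (cllin a (x, f x) (y, f y)).
pose F := GRing.isLinear.Build _ _ _ _ f flin.
pose g : {linear H -> H} := HB.pack f F.
exists g; split; first by exists M => x y; rewrite /graph /= => ->; apply: clb; exact: fP.
move=> x y Txy; apply: (cluniq x); first exact: fP.
exact: subset_closure.
Qed.

Lemma dense_inner_eq T (f : {linear H -> H}) y z :
  densely_defined T -> is_bounded (graph f) ->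
  (forall u v, T (u, v) -> inner (f u) y = inner u z) ->
  forall x, inner (f x) y = inner x z.
Proof.
move=> dT [M bf] eqT x; apply/eqP; rewrite -subr_eq0 -normr_le0.
apply: (@le_mul_eps_le0 _ _ (`|M| * `|y| + `|z|)) => e e0.
have [u [v [Tuv xu]]] := dense_approx _ x _ dT e0.
have -> : inner (f x) y - inner x z = inner (f (x - u)) y - inner (x - u) z.
  by rewrite linearB !innerE (eqT _ _ Tuv); ring.
rewrite (le_trans (ler_normB _ _)) // mulrDl mulrAC lerD //.
  rewrite (le_trans (Cauchy_Schwarz _ _)) // ler_wpM2r //.
  rewrite (le_trans (bf _ _ erefl)) //.
  by rewrite (le_trans (ler_wpM2r _ (ler_norm M))) // ler_wpM2l // ltW.
by rewrite (le_trans (Cauchy_Schwarz _ _)) // mulrC ler_wpM2l // ltW.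
Qed.

Lemma dense_symmetric T (f : {linear H -> H}) :
  densely_defined T -> is_bounded (graph f) ->
  (forall u v u' v', T (u, v) -> T (u', v') -> inner (f u) u' = inner u (f u')) ->
  forall x y, inner (f x) y = inner x (f y).
Proof.
move=> dT bf symT x y; apply: (dense_inner_eq T) => // u v Tuv.
rewrite innerC (innerC u) -(dense_inner_eq T f u (f u)) // => u' v' Tuv'.
exact: symT Tuv' Tuv.
Qed.

Lemma continuous_is_bounded (f : {linear H -> H}) :
  continuous f -> is_bounded (graph f).
Proof.
move=> /linear_bounded_continuous/linear_boundedP [M [_ bM]].
exists (M + 1) => x y; rewrite /graph /= => ->; by apply: bM; rewrite ltrDl.
Qed.

Lemma is_bounded_graphP (f : H -> H) :
  is_bounded (graph f) <->
  exists2 M : R, 0 <= M & forall x, `|f x| <= M * `|x|.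
Proof.
split=> [[M bM]|[M _ bM]].
  exists `|M| => // x; apply: le_trans (bM x (f x) erefl) _.
  by rewrite ler_wpM2r // ler_norm.
by exists M => x y; rewrite /graph /= => ->.
Qed.

Lemma is_bounded_comp (f g : H -> H) :
  is_bounded (graph f) -> is_bounded (graph g) -> is_bounded (graph (f \o g)).
Proof.
move=> /is_bounded_graphP[M M0 fM] /is_bounded_graphP[K K0 gK].
apply/is_bounded_graphP; exists (M * K); first exact: mulr_ge0.
by move=> x; rewrite (le_trans (fM _)) // -mulrA ler_wpM2l.
Qed.

Lemma is_bounded_sub (f g : H -> H) :
  is_bounded (graph f) -> is_bounded (graph g) -> is_bounded (graph (f \- g)).
Proof.
move=> /is_bounded_graphP[M M0 fM] /is_bounded_graphP[K K0 gK].
apply/is_bounded_graphP; exists (M + K); first exact: addr_ge0.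
by move=> x; rewrite (le_trans (ler_normB _ _)) // mulrDl lerD.
Qed.

End Bounded.

(** * The projection theorem *)

Section Projection.
Context {R : realType} {H : hilbertType R}.
Implicit Types (x y z : H) (V : set H).

Lemma parallelogram x y :
  `|x + y| ^+ 2 + `|x - y| ^+ 2 = 2 * (`|x| ^+ 2 + `|y| ^+ 2).
Proof. by rewrite -!inner_norm !innerE; ring. Qed.

(** Almost minimizers of the distance from [y] to [V] are close to each other
    by the parallelogram law; their limit [l] inherits orthogonality from their
    almost orthogonality. Closedness of [V] is stated with approximations, as
    this is the form in which it is proved for ranges of operators. *)
Lemma projection V y :
  V 0 -> (forall a u v, V u -> V v -> V (a *: u + v)) ->
  (forall v, (forall e, 0 < e -> exists2 u, V u & `|v - u| <= e) -> V v) ->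
  exists2 l, V l & forall u, V u -> inner (y - l) u = 0.
Proof.
move=> V0 Vlin Vcl.
pose D := [set `|y - v| ^+ 2 | v in V].
have Dlb : has_lbound D by exists 0 => _ [v _ <-]; exact: sqr_ge0.
have Dle v : V v -> inf D <= `|y - v| ^+ 2 by move=> Vv; apply: ge_inf => //; exists v.
pose P (e : R) v := V v /\ `|y - v| ^+ 2 <= inf D + e ^+ 2.
have Ptest e v u t : P e v -> V u -> inf D <= `|y - v - t *: u| ^+ 2.
  move=> [Vv _] Vu; have -> : y - v - t *: u = y - (t *: u + v).
    by apply: inner_inj => w; rewrite !innerE; ring.
  exact/Dle/Vlin.
have hD : has_inf D by split=> //; exists (`|y - 0| ^+ 2), 0.
have P0 e : 0 < e -> P e !=set0.
  move=> e0; have [_ [v Vv <-] vD] := inf_adherent (exprn_gt0 2 e0) hD.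
  by exists v; split=> //; exact: ltW.
have [//|||l lP] := @nested_limit _ _ P 2.
- move=> d e d0 de v [Vv vD]; split=> //; apply: le_trans vD _.
  by rewrite lerD2l ler_pXn2r // nnegrE ltW // (lt_le_trans d0).
- move=> e v v' e0 Pv Pv'.
  have := parallelogram (y - v) (y - v').
  have -> : y - v - (y - v') = - (v - v').
    by apply: inner_inj => w; rewrite !innerE; ring.
  have -> : y - v + (y - v') = 2 *: (y - v - 2^-1 *: (v' - v)).
    by apply: inner_inj => w; rewrite !innerE; field.
  rewrite normrN normrZ exprMn ger0_norm // => eq.
  have Vd : V (v' - v).
    by rewrite -scaleN1r addrC; apply: Vlin; [exact: Pv.1|exact: Pv'.1].
  have := Ptest _ _ _ 2^-1 Pv Vd; have := Pv.2; have := Pv'.2 => h1 h2 h3.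
  rewrite -(@ler_pXn2r _ 2) ?nnegrE ?mulr_ge0 ?(ltW e0) //.
  by rewrite exprMn; lra.
have Pex e : 0 < e -> exists2 v, P e v & `|l - v| <= 2 * e.
  by move=> e0; have [v Pv] := P0 _ e0; exists v => //; exact: lP.
exists l => [|u Vu].
  apply: Vcl => e e0; have e2 : 0 < e / 2 by rewrite divr_gt0.
  have [v Pv lv] := Pex _ e2; exists v; first exact: Pv.1.
  by rewrite (le_trans lv) // mulrC divfK.
apply/eqP; rewrite -normr_le0; apply: (@le_mul_eps_le0 _ _ (3 * `|u|)) => e e0.
have [v Pv lv] := Pex _ e0.
have uv : `|inner (y - v) u| <= e * `|u|.
  rewrite -(@ler_pXn2r _ 2) ?nnegrE ?mulr_ge0 ?(ltW e0) //.
  rewrite real_normK ?num_real // exprMn.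
  apply: quadratic_bound => // [|t]; first exact: ltW.
  have := Ptest _ _ _ t Pv Vu; have := Pv.2.
  suff -> : `|y - v - t *: u| ^+ 2 =
    `|y - v| ^+ 2 - 2 * t * inner (y - v) u + `|u| ^+ 2 * t ^+ 2 by lra.
  rewrite -!inner_norm !innerE (innerC u) (innerC v) (innerC u v) (innerC y v).
  ring.
have -> : inner (y - l) u = inner (y - v) u - inner (l - v) u.
  by rewrite !innerE; ring.
rewrite (le_trans (ler_normB _ _)) //.
have lvu : `|inner (l - v) u| <= 2 * e * `|u|.
  by rewrite (le_trans (Cauchy_Schwarz _ _)) // ler_wpM2r.
by apply: le_trans (lerD uv lvu) _; rewrite le_eqVlt; apply/orP; left; apply/eqP; ring.
Qed.

End Projection.

(** * Skew-selfadjoint operators and their resolvents *)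

Section SkewSelfadjoint.
Context {R : realType} {H : hilbertType R}.
Implicit Types (x y z : H) (T : set (H * H)).

Lemma skew_selfadjoint_opscale (c : R) T :
  c != 0 -> skew_selfadjoint T -> skew_selfadjoint (opscale c T).
Proof.
move=> c0 [oT dT skT]; split.
- exact: is_operator_opscale.
- apply: (densely_defined_sub T) => // x y Txy.
  by exists (c *: y), y.
- apply/seteqP; split=> -[x y].
    move=> Txy; have : adjoint T (c *: x, y).
      move=> u v Tuv /=; rewrite innerZr -innerZl.
      by apply: Txy; exists v.
    rewrite skT => /opoppP Tx; apply/opoppP; exists (c^-1 *: (- y)) => /=.
      have [T0 lin _] := oT.
      have : T (c^-1 *: (c *: x) + 0, c^-1 *: - y + 0) := lin c^-1 _ _ Tx T0.
      by rewrite !addr0 scalerA mulVf // scale1r.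
    by rewrite scalerA mulfV // scale1r.
move=> /opoppP [v Tv /= yv] x' y' [v' Tv' /= ->].
have /(_ _ _ Tv') /= : adjoint T (x, - v) by rewrite skT; apply/opoppP; rewrite opprK.
by rewrite innerZl => ->; rewrite -(opprK y) yv !innerE; ring.
Qed.

(** The closure of a skew-symmetric operator is contained in minus its
    adjoint; equality only has to be tested in the other direction. *)
Lemma closure_skew_selfadjoint T : is_operator T -> densely_defined T ->
  (forall x y x' y', T (x, y) -> T (x', y') -> inner y x' = - inner x y') ->
  (forall x y, adjoint T (x, y) -> closure T (x, - y)) ->
  skew_selfadjoint (closure T).
Proof.
move=> oT dT skT adjT.
have oA := is_operator_adjoint _ dT.
have cl_adj x y : closure T (x, y) -> adjoint T (x, - y).
  move=> clT; apply: adjoint_closed; apply/closureP => e e0.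
  have [u [v [Tuv xu yv]]] := (closureP _ _ _).1 clT _ e0.
  exists u, (- v); split=> //; last by rewrite -opprD normrN.
  by move=> u' v' Tuv' /=; rewrite (skT _ _ _ _ Tuv' Tuv) innerNr.
split.
- have [T0 lin _] := oT; split; first exact: subset_closure.
    by move=> a p q; apply: closure_linear; exact: lin.
  move=> x y z /cl_adj Ty /cl_adj Tz; apply: oppr_inj.
  by have [_ _ uniq] := oA; exact: uniq Ty Tz.
- apply: (densely_defined_sub T) => // x y Txy.
  by exists y; exact: subset_closure.
- rewrite adjoint_closure; apply/seteqP; split=> -[x y].
    by move=> /adjT ?; apply/opoppP.
  by move=> /opoppP /cl_adj; rewrite opprK.
Qed.

Section Resolvent.
Context (A : set (H * H)) (skA : skew_selfadjoint A).

Lemma skew_selfadjoint_inner x a x' a' :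
  A (x, a) -> A (x', a') -> inner a x' = - inner x a'.
Proof.
have [_ _ adjA] := skA.
move=> Axa Axa'; rewrite -innerNr.
have : adjoint A (x', - a') by rewrite adjA; apply/opoppP; rewrite opprK.
exact.
Qed.

(** Skew-symmetry makes [A x] orthogonal to [x]. Hence the resolvent of [A]
    and the resolvent defect [y - (1 + e A)^-1 y] are both contractions. *)
Lemma normD_skew x a (e : R) : A (x, a) ->
  `|x + e *: a| ^+ 2 = `|x| ^+ 2 + `|e *: a| ^+ 2.
Proof.
move=> Axa; have ax0 : inner a x = 0.
  by have := skew_selfadjoint_inner _ _ _ _ Axa Axa; rewrite (innerC x); lra.
by rewrite -!inner_norm !innerE (innerC x) ax0; ring.
Qed.

Lemma resolvent_le x a (e : R) : A (x, a) -> `|x| <= `|x + e *: a|.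
Proof.
move=> Axa; rewrite -(@ler_pXn2r _ 2) ?nnegrE //.
by rewrite normD_skew // lerDl sqr_ge0.
Qed.

Lemma resolvent_defect_le x a (e : R) : A (x, a) -> `|e *: a| <= `|x + e *: a|.
Proof.
move=> Axa; rewrite -(@ler_pXn2r _ 2) ?nnegrE //.
by rewrite normD_skew // lerDr sqr_ge0.
Qed.

Lemma skew_selfadjoint_closed : closure A `<=` A.
Proof.
have [_ _ adjA] := skA.
move=> [x a] clA; have : adjoint A (x, - a).
  apply: adjoint_closed; apply/closureP => e e0.
  have [u [v [Auv xu av]]] := (closureP _ _ _).1 clA _ e0.
  exists u, (- v); split=> //; last by rewrite -opprD normrN.
  by rewrite adjA; apply/opoppP; rewrite opprK.
by rewrite adjA => /opoppP; rewrite opprK.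
Qed.

(** The range of [1 + e A] is closed because [1 + e A] does not shrink
    distances. A vector [u] orthogonal to it satisfies [e A^* u = - u], that
    is, [e A u = u], and must vanish because [A u] is orthogonal to [u]. *)
Lemma resolvent_surj (e : R) y : 0 < e ->
  exists x a, A (x, a) /\ x + e *: a = y.
Proof.
move=> e0; have eN0 : e != 0 by rewrite gt_eqF.
have [[A0 Alin Auniq] dA adjA] := skA.
pose V v := exists x a, A (x, a) /\ x + e *: a = v.
have [|||l Vl orth] := @projection _ _ V y.
- by exists 0, 0; rewrite scaler0 addr0.
- move=> c _ _ [x [a [Axa <-]]] [x' [a' [Axa' <-]]].
  exists (c *: x + x'), (c *: a + a'); split; first exact: (Alin c _ _ Axa Axa').
  by apply: inner_inj => w; rewrite !innerE; ring.
- move=> v near_v.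
  (* Only the first components need a limit [x]; the second one is then forced
     to be [e^-1 *: (v - x)], and closedness of [A] does the rest. *)
  pose P (d : R) x := exists2 a, A (x, a) & `|v - (x + e *: a)| <= d.
  have [|||x xP] := @nested_limit _ _ P 2.
  + move=> d d0; have [_ [x [a [Axa <-]]] va] := near_v _ d0.
    by exists x, a.
  + by move=> d d' _ dd' x [a Axa va]; exists a => //; exact: le_trans dd'.
  + move=> d x x' d0 [a Axa va] [a' Axa' va'].
    have := resolvent_le _ _ e (operatorB _ _ _ _ _ (And3 A0 Alin Auniq) Axa Axa').
    have -> : x - x' + e *: (a - a') =
        (v - (x' + e *: a')) - (v - (x + e *: a)).
      by apply: inner_inj => w; rewrite !innerE; ring.
    move=> /le_trans; apply; rewrite (le_trans (ler_normB _ _)) //; lra.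
  exists x, (e^-1 *: (v - x)); split; last first.
    by rewrite scalerA mulfV // scale1r addrC subrK.
  apply: skew_selfadjoint_closed; apply/closureP => d d0.
  (* [v] is within [d'] of [u + e *: a] and [x] within [2 * d'] of [u], so the
     second components differ by at most [e^-1 * (3 * d')]. *)
  pose d' := d / (3 * (1 + e^-1)).
  have ei0 : 0 < e^-1 by rewrite invr_gt0.
  have d'0 : 0 < d' by rewrite divr_gt0 // mulr_gt0 // addr_gt0.
  have dE : d = 3 * d' + e^-1 * (3 * d').
    by rewrite /d'; field; rewrite eN0 /= gt_eqF // addr_gt0.
  have [_ [u [a [Aua <-]]] va] := near_v _ d'0.
  have xu : `|x - u| <= 2 * d' by apply: xP => //; exists a.
  exists u, a; split=> //.
    have : 0 < e^-1 * (3 * d') by rewrite mulr_gt0 // mulr_gt0.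
    by lra.
  have -> : e^-1 *: (v - x) - a = e^-1 *: ((v - (u + e *: a)) - (x - u)).
    by apply: inner_inj => w; rewrite !innerE; field.
  rewrite normrZ gtr0_norm //.
  have : e^-1 * `|v - (u + e *: a) - (x - u)| <= e^-1 * (3 * d').
    rewrite ler_wpM2l ?(ltW ei0) // (le_trans (ler_normB _ _)) //; lra.
  by lra.
suff u0 : y - l = 0 by rewrite -(subrK l y) u0 add0r.
move: (y - l) orth => u orth.
have : adjoint A (u, - e^-1 *: u).
  move=> x a Axa /=; have := orth (x + e *: a) (ex_intro _ x (ex_intro _ a (conj Axa erefl))).
  rewrite !innerE (innerC a) (innerC x) => h.
  have -> : inner u x = - (e * inner u a) by lra.
  by field.
rewrite adjA => /opoppP; rewrite scaleNr opprK => Au.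
apply: inner_self_eq0.
have := skew_selfadjoint_inner _ _ _ _ Au Au.
rewrite !innerE => h; have : 2 * (e^-1 * inner u u) = 0 by lra.
by move=> /eqP; rewrite !mulf_eq0 pnatr_eq0 invr_eq0 (negbTE eN0) => /eqP.
Qed.

(** The defect [e *: a = y - (1 + e A)^-1 y] tends to [0]: it does so for [y]
    in [dom A], and [y |-> e *: a] is a contraction for every [e]. *)
Lemma resolvent_cvg y (d : R) : 0 < d ->
  exists2 e0, 0 < e0 & forall e x a, 0 < e -> e <= e0 -> A (x, a) ->
    x + e *: a = y -> `|e *: a| <= d.
Proof.
have [oA dA adjA] := skA.
move=> d0; have d2 : 0 < d / 2 by rewrite divr_gt0.
have [u [v [Auv yu]]] := dense_approx _ y _ dA d2.
have v1 : 0 < `|v| + 1 by rewrite ltr_pwDr.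
exists (d / (4 * (`|v| + 1))); first by rewrite divr_gt0 // mulr_gt0.
move=> e x a e0 ele Axa eqy.
have ev : e * `|v| <= d / 4.
  have : d / (4 * (`|v| + 1)) * (`|v| + 1) = d / 4.
    by field; rewrite gt_eqF.
  have := ler_wpM2r (ltW v1) ele.
  by rewrite mulrDr; lra.
have := resolvent_defect_le _ _ e (operatorB _ _ _ _ _ oA Axa Auv).
have -> : x - u + e *: (a - v) = (y - u) - e *: v.
  by rewrite -eqy; apply: inner_inj => w; rewrite !innerE; ring.
have -> : e *: (a - v) = e *: a - e *: v.
  by rewrite scalerBr.
have := ler_normB (y - u) (e *: v); have := ler_normD (e *: a - e *: v) (e *: v).
by rewrite subrK (normrZ e v) (gtr0_norm e0); lra.
Qed.

End Resolvent.
End SkewSelfadjoint.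


(** * Multiplication of a skew-selfadjoint operator by a bounded one *)

Section Commutator.
Context {R : realType} {H : hilbertType R}.
Implicit Types (x y z : H).
Context (A : set (H * H)) (skA : skew_selfadjoint A).
Context (alpha N P : {linear H -> H}).
Hypotheses (bN : is_bounded (graph N)) (bP : is_bounded (graph P)).
Hypothesis alpha_dom : forall x a, A (x, a) -> exists b, A (alpha x, b).
Hypothesis alpha_comm : forall x a b,
  A (x, a) -> A (alpha x, b) -> alpha a - b = N x.
Hypothesis alpha_sym : forall x y, inner (alpha x) y = inner x (alpha y).
Hypothesis P_skew : forall x y, inner (P x) y = - inner x (P y).

Lemma commutator_sym x y : inner (N x) y = inner x (N y).
Proof.
have [_ dA _] := skA.
move: x y; apply: (dense_symmetric A) => // x a x' a' Axa Axa'.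
have [b Ab] := alpha_dom _ _ Axa; have [b' Ab'] := alpha_dom _ _ Axa'.
rewrite -(alpha_comm _ _ _ Axa Ab) -(alpha_comm _ _ _ Axa' Ab') !innerE.
rewrite alpha_sym -(alpha_sym x) (skew_selfadjoint_inner _ skA _ _ _ _ Axa Ab').
by rewrite (skew_selfadjoint_inner _ skA _ _ _ _ Ab Axa'); ring.
Qed.

(** Approximate [y] by [x = (1 + e A)^-1 y], and let [a = A x] and
    [b' = A (alpha x)], so that [alpha a = b' + N x]. It has to be shown that
    [b' - b] is small. Applying [1 + e A] to [h := alpha x - alpha y], for which
    [A h = b' - b], gives [h + e (b' - b) = - e (b + N x)]. So [b' - b] is, up
    to sign, the resolvent defect of [b + N x]; it is close to the defect
    [e *: q] of the fixed vector [w := b + N y], which tends to [0]. *)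
Lemma closure_mul y b : A (alpha y, b) ->
  closure [set p | exists2 a, A (p.1, a) & p.2 = alpha a] (y, b + N y).
Proof.
move=> Ab; have [oA _ _] := skA; have [M bM] := bN.
have NM x : `|N x| <= `|M| * `|x|.
  apply: le_trans (bM x (N x) erefl) _.
  by rewrite ler_wpM2r // ler_norm.
apply/closureP => d d0.
have M1 : 0 < 2 * `|M| + 2 by rewrite ltr_wpDl // mulr_ge0.
pose d' := d / (2 * `|M| + 2).
have d'0 : 0 < d' by rewrite divr_gt0.
have dE : d = 2 * (`|M| * d') + 2 * d' by rewrite /d'; field; rewrite gt_eqF.
have Md' : 0 <= `|M| * d' by rewrite mulr_ge0 // ltW.
set w := b + N y.
have [e1 e10 cv1] := resolvent_cvg _ skA y _ d'0.
have [e2 e20 cv2] := resolvent_cvg _ skA w _ d'0.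
pose e := Num.min e1 e2.
have e0 : 0 < e by rewrite lt_min e10.
have [x [a [Axa xay]]] := resolvent_surj _ skA e y e0.
have [p [q [Apq pqw]]] := resolvent_surj _ skA e w e0.
have ead : `|e *: a| <= d' by apply: cv1 xay => //; rewrite ge_min lexx.
have eqd : `|e *: q| <= d' by apply: cv2 pqw => //; rewrite ge_min lexx orbT.
have yx : y - x = e *: a by rewrite -xay addrC addKr.
have [b' Ab'] := alpha_dom _ _ Axa.
have Nx := alpha_comm _ _ _ Axa Ab'.
exists x, (alpha a); split; first by exists a.
  by rewrite yx; lra.
have Ah := operatorB _ _ _ _ _ oA Ab' Ab.
have hE : alpha x - alpha y = - (e *: alpha a).
  by rewrite -opprB -linearB yx linearZ.
have [_ Alin _] := oA.
have AH := Alin e _ _ Apq Ah.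
have := resolvent_defect_le _ skA _ _ e AH.
have -> : e *: p + (alpha x - alpha y) + e *: (e *: q + (b' - b)) =
    e *: N (y - x).
  rewrite hE linearB -Nx.
  have -> : N y = p + e *: q - b by rewrite pqw /w addrAC subrr add0r.
  by apply: inner_inj => z; rewrite !innerE; ring.
rewrite !normrZ !gtr0_norm // ler_pM2l // yx => k_le.
have NeA : `|N (e *: a)| <= `|M| * d'.
  by rewrite (le_trans (NM _)) // ler_wpM2l.
have -> : w - alpha a = (e *: q - (e *: q + (b' - b))) + N (e *: a).
  rewrite -yx linearB -Nx /w.
  by apply: inner_inj => z; rewrite !innerE; ring.
have := ler_normD (e *: q - (e *: q + (b' - b))) (N (e *: a)).
have := ler_normB (e *: q) (e *: q + (b' - b)).
lra.
Qed.

(** Let [(y, z)] be in the adjoint of [2 alpha A - N + P], that is, of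
    [A alpha + alpha A + P]. Moving the bounded operators to the other side
    shows that [2 *: alpha y] is in the domain of [A^* = - A], with
    [A (alpha y) = b := - (z + N y + P y) / 2]. Then [closure_mul] approximates
    [y] by vectors [u] at which [2 alpha A - N + P] is close to
    [2 (b + N y) - N y + P y = - z]. *)
Lemma skew_selfadjoint_mul :
  skew_selfadjoint (closure
    [set p | exists2 a, A (p.1, a) & p.2 = 2 *: alpha a - N p.1 + P p.1]).
Proof.
have [[A0 Alin Auniq] dA adjA] := skA.
apply: closure_skew_selfadjoint.
- split.
  + by exists 0 => //=; rewrite !linear0 !addr0.
  + move=> c [x r] [x' r'] [a Axa /= ->] [a' Axa' /= ->].
    exists (c *: a + a'); first exact: (Alin c _ _ Axa Axa').
    rewrite /= !linearP; apply: inner_inj => w; rewrite !innerE; ring.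
  + by move=> x r r' [a Axa /= ->] [a' Axa' /= ->]; rewrite (Auniq _ _ _ Axa Axa').
- apply: (densely_defined_sub A) => // x a Axa.
  by exists (2 *: alpha a - N x + P x), a.
- move=> x r x' r' [a Axa /= ->] [a' Axa' /= ->].
  have [b' Ab'] := alpha_dom _ _ Axa'.
  rewrite !innerE alpha_sym (skew_selfadjoint_inner _ skA _ _ _ _ Axa Ab').
  have -> : b' = alpha a' - N x'.
    by rewrite -(alpha_comm _ _ _ Axa' Ab') opprB addrC subrK.
  by rewrite commutator_sym P_skew !innerE; ring.
- move=> y z adjz.
  have : adjoint A (2 *: alpha y, z + N y + P y).
    move=> u a Aua /=.
    have /= : inner (2 *: alpha a - N u + P u) y = inner u z.
      by apply: adjz; exists a.
    by rewrite !innerE -alpha_sym commutator_sym P_skew; lra.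
  rewrite adjA => /opoppP A2.
  pose b := - (2^-1 *: (z + N y + P y)).
  have Ab : A (alpha y, b).
    have : A (2^-1 *: (2 *: alpha y) + 0, 2^-1 *: - (z + N y + P y) + 0) :=
      Alin 2^-1 _ _ A2 A0.
    by rewrite !addr0 scalerA mulVf ?pnatr_eq0 // scale1r scalerN.
  have cl := closure_mul _ _ Ab.
  have /is_bounded_graphP[M M0 bM] := is_bounded_sub _ _ bP bN.
  apply/closureP => e e0.
  have M3 : 0 < M + 3 by rewrite ltr_wpDl.
  pose d := e / (M + 3).
  have d0 : 0 < d by rewrite divr_gt0.
  have eE : e = M * d + 3 * d by rewrite /d; field; rewrite gt_eqF.
  have Md : 0 <= M * d by rewrite mulr_ge0 // ltW.
  have [u [_ [[a /= Aua ->] yu va]]] := (closureP _ _ _).1 cl _ d0.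
  exists u, (2 *: alpha a - N u + P u); split; first by exists a.
    by lra.
  have -> : - z - (2 *: alpha a - N u + P u) =
      2 *: (b + N y - alpha a) + (P \- N) (y - u).
    rewrite /b /= !linearB /=.
    by apply: inner_inj => w; rewrite !innerE; field.
  apply: le_lt_trans (ler_normD _ _) _; rewrite normrZ ger0_norm //.
  have := bM (y - u); have := ler_wpM2l M0 (ltW yu); lra.
Qed.
End Commutator.

(** * Quasi-skew-selfadjoint operators *)

Section QuasiSkewSelfadjoint.
Context {R : realType} {H : hilbertType R}.
Implicit Types (x y z : H) (C T : set (H * H)).

Lemma dom_eq_exists C T x c :
  dom C = dom T -> C (x, c) -> exists c', T (x, c').
Proof.
move=> domCT Cxc; have : dom T x by rewrite -domCT; exists (x, c).
by move=> [[u c'] Tc' /= <-]; exists c'.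
Qed.

(** [2 *: S] is the extension of [C + C^*]. If [(y, z)] is in the adjoint of
    [C - S], then [(y, z + S y)] is in the adjoint of [C]; so [y] belongs to
    [dom C], and [z = C^* y - S y = S y - C y]. *)
Lemma quasi_skew_selfadjoint_split C :
  is_operator C -> densely_defined C -> quasi_skew_selfadjoint C ->
  exists S : {linear H -> H},
    [/\ is_bounded (graph S), forall x y, inner (S x) y = inner x (S y),
        forall x c c', C (x, c) -> adjoint C (x, c') -> c' = 2 *: S x - c &
        skew_selfadjoint [set p : H * H | C (p.1, p.2 + S p.1)]].
Proof.
move=> oC dC [domC bsym]; have [C0 Clin Cuniq] := oC.
have adjC x c : C (x, c) -> exists c', adjoint C (x, c').
  exact: dom_eq_exists.
have [S [bS SE]] : exists S : {linear H -> H}, is_bounded (graph S) /\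
    forall x c c', C (x, c) -> adjoint C (x, c') -> c' = 2 *: S x - c.
  have [||| S [bS SE]] :=
    bounded_extension (opscale 2^-1 (opadd C (adjoint C))).
  - apply: is_operator_opscale; apply: is_operator_opadd => //.
    exact: is_operator_adjoint.
  - apply: (densely_defined_sub C) => // x c Cxc.
    have [c' Cxc'] := adjC _ _ Cxc.
    by exists (2^-1 *: (c + c')), (c + c') => //; exists c, c'.
  - have [M bM] := bsym; exists M => x y [z Tz yz]; apply: bM.
    by exists z => //; exact: subset_closure.
  exists S; split=> // x c c' Cxc Cxc'.
  rewrite (SE x (2^-1 *: (c + c'))).
    by apply: inner_inj => w; rewrite !innerE; field.
  by exists (c + c') => //; exists c, c'.
have S_sym : forall x y, inner (S x) y = inner x (S y).
  apply: (dense_symmetric C) => // x c x' c' Cxc Cxc'.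
  have [d Cxd] := adjC _ _ Cxc; have [d' Cxd'] := adjC _ _ Cxc'.
  have := Cxd _ _ Cxc'; have := Cxd' _ _ Cxc; rewrite /=.
  rewrite (SE _ _ _ Cxc Cxd) (SE _ _ _ Cxc' Cxd') !innerE.
  by rewrite (innerC x' c) (innerC x' (S x)) (innerC c' x); lra.
exists S; split=> //.
pose A := [set p : H * H | C (p.1, p.2 + S p.1)]; rewrite -/A.
have CA x c : C (x, c) -> A (x, c - S x) by rewrite /A /= subrK.
split.
- split; first by rewrite /A /= linear0 addr0.
    move=> r [x a] [x' a'] Axa Axa'; rewrite /A /= linearP.
    have := Clin r _ _ Axa Axa'; congr C; congr (_, _) => /=.
    by apply: inner_inj => w; rewrite !innerE; ring.
  move=> x a a' Axa Axa'; apply: (addIr (S x)); exact: Cuniq Axa Axa'.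
- by apply: (densely_defined_sub C) => // x c /CA; exists (c - S x).
apply/seteqP; split=> -[y z].
  move=> adjz; have Cadj : adjoint C (y, z + S y).
    move=> x c Cxc; have /= := adjz _ _ (CA _ _ Cxc).
    by rewrite !innerE S_sym; lra.
  have [c Cyc] := dom_eq_exists _ _ _ _ (esym domC) Cadj.
  apply/opoppP; rewrite /A /=; suff <- : c = - z + S y by [].
  have -> : z = 2 *: S y - c - S y by rewrite -(SE _ _ _ Cyc Cadj) addrK.
  by apply: inner_inj => w; rewrite !innerE; ring.
move=> /opoppP; rewrite /A /= => Cy x a; rewrite /A /= => Cx.
have [d Cyd] := adjC _ _ Cy; have /= := Cyd _ _ Cx.
by rewrite (SE _ _ _ Cy Cyd) !innerE S_sym; lra.
Qed.

Lemma commutator_extension C (alpha : {linear H -> H}) :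
  is_operator C -> densely_defined C ->
  (forall x c, C (x, c) -> exists c', C (alpha x, c')) ->
  is_bounded (commutator (graph alpha) C) ->
  exists N : {linear H -> H}, is_bounded (graph N) /\
    forall x c c', C (x, c) -> C (alpha x, c') -> alpha c - c' = N x.
Proof.
move=> oC dC alpha_dom bcomm.
have commE x c c' : C (x, c) -> C (alpha x, c') ->
    commutator (graph alpha) C (x, alpha c - c').
  move=> Cxc Cc'; apply/opsubP; exists (alpha c), c'; split=> //.
    by exists c.
  by exists (alpha x).
have [||// | N [bN NE]] := bounded_extension (commutator (graph alpha) C).
- by apply: is_operator_opsub; apply: is_operator_opcomp => //;
    exact: is_operator_graph.
- apply: (densely_defined_sub C) => // x c Cxc.
  have [c' Cc'] := alpha_dom _ _ Cxc.
  by exists (alpha c - c'); exact: commE.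
by exists N; split=> // x c c' Cxc Cc'; rewrite (NE _ _ (commE _ _ _ Cxc Cc')).
Qed.

End QuasiSkewSelfadjoint.

(** * The skew part of the product *)

Theorem theorem3p12 (R : realType) (H : hilbertType R)
    (C : set (H * H)) (alpha : {linear H -> H}) :
  is_operator C -> closed C -> densely_defined C ->
  quasi_skew_selfadjoint C ->
  continuous alpha -> selfadjoint (graph alpha) ->
  alpha @` dom C `<=` dom C ->
  is_bounded (commutator (graph alpha) C) ->
  skew_selfadjoint (skew_part (opcomp (graph alpha) C)).
Proof.
move=> oC _ dC qC alpha_cont [_ _ adj_alpha] alpha_dom bcomm.
have ba := continuous_is_bounded _ alpha_cont.
have alpha_sym x y : inner (alpha x) y = inner x (alpha y).
  have : graph alpha (y, alpha y) by [].
  by rewrite -adj_alpha => /(_ x (alpha x)) /=; apply.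
have alpha_C x c : C (x, c) -> exists c', C (alpha x, c').
  move=> Cxc; have [|[u c'] Cuc' /= <-] := alpha_dom (alpha x); last by exists c'.
  by exists x => //; exists (x, c).
have [S [bS S_sym SE skA]] := quasi_skew_selfadjoint_split _ oC dC qC.
have [N' [bN' N'E]] := commutator_extension _ _ oC dC alpha_C bcomm.
pose A := [set p : H * H | C (p.1, p.2 + S p.1)]; rewrite -/A in skA.
have CA x c : C (x, c) -> A (x, c - S x) by rewrite /A /= subrK.
pose P : {linear H -> H} := (alpha \o S) \- (S \o alpha).
pose N : {linear H -> H} := N' \- P.
have bP : is_bounded (graph P) by apply: is_bounded_sub; exact: is_bounded_comp.
have bN : is_bounded (graph N) by exact: is_bounded_sub.
have alpha_A x a : A (x, a) -> exists b, A (alpha x, b).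
  by move=> /alpha_C [c /CA]; exists (c - S (alpha x)).
have comm_A x a b : A (x, a) -> A (alpha x, b) -> alpha a - b = N x.
  move=> Axa Ab; rewrite /N /P /= -(N'E _ _ _ Axa Ab) linearD /=.
  by apply: inner_inj => w; rewrite !innerE; ring.
have P_skew x y : inner (P x) y = - inner x (P y).
  by rewrite /P /= !innerE alpha_sym !S_sym -alpha_sym; ring.
have adj_A x b : A (alpha x, b) -> adjoint C (alpha x, S (alpha x) - b).
  move=> Ab; have [d Cd] := dom_eq_exists _ _ _ _ qC.1 Ab.
  suff <- : d = S (alpha x) - b by [].
  rewrite (SE _ _ _ Ab Cd).
  by apply: inner_inj => w; rewrite !innerE; ring.
apply: skew_selfadjoint_opscale; first by rewrite invr_eq0 pnatr_eq0.
have := skew_selfadjoint_mul _ skA _ _ _ bN bP alpha_A comm_A alpha_sym P_skew.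
congr (skew_selfadjoint (closure _)).
(* A value of [alpha C] at [x] is [alpha (a + S x)], with [a = A x]. Since
   [(alpha C)^* = C^* alpha], a value of [(alpha C)^*] there is
   [S (alpha x) - b], with [b = A (alpha x) = alpha a - N x]. *)
apply/seteqP; split=> -[x y].
  move=> [a Axa /= ->]; have [b Ab] := alpha_A _ _ Axa.
  apply/opsubP; exists (alpha (a + S x)), (S (alpha x) - b); split.
  - by exists (a + S x).
  - move=> u v [c Cuc]; rewrite /graph /= => ->; rewrite alpha_sym.
    exact: adj_A Ab _ _ Cuc.
  - have -> : b = alpha a - N x.
      by rewrite -(comm_A _ _ _ Axa Ab) opprB addrC subrK.
    rewrite (linearD alpha) /N /P /=.
    by apply: inner_inj => w; rewrite !innerE; ring.
move=> /opsubP [u [v [[c /= Cxc]]]]; rewrite /graph /= => -> adjv ->.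
have Axa := CA _ _ Cxc; have [b Ab] := alpha_A _ _ Axa.
exists (c - S x) => //=.
have -> : v = S (alpha x) - b.
  have [_ _ uniq] := is_operator_adjoint _ dC; apply: (uniq (alpha x)).
    by move=> t e Cte /=; rewrite -alpha_sym; apply: adjv; exists e.
  exact: adj_A.
have -> : b = alpha (c - S x) - N x.
  by rewrite -(comm_A _ _ _ Axa Ab) opprB addrC subrK.
rewrite (linearB alpha) /N /P /=.
by apply: inner_inj => w; rewrite !innerE; ring.
Qed.
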